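(* Let $k\geq 3$ and let $\Gamma_k$ be the marked group $\mathbb{Z}/k\mathbb{Z}\times\mathbb{Z}$ with generating set consisting of the elements $(i,0)$ for $i\neq 0$, $(i,1)$ for $i\notin\{0,1\}$, and $(-i,-1)$ for $i\notin\{0,1\}$ (where $i$ ranges over $\mathbb{Z}/k\mathbb{Z}$). Then $\chi_B(F(2^{\Gamma_k}))=k$.
   Context: A marked group is a finitely generated group $\Gamma$ with a finite symmetric generating set $S$ not containing the identity. The left shift action of $\Gamma$ on $2^\Gamma$ is $(g\cdot x)(h)=x(g^{-1}h)$; its free part is $F(2^\Gamma)=\{x\in 2^\Gamma : g\cdot x\neq x \text{ for all } g\neq \mathrm{id}\}$. The shift graph $F(2^\Gamma)$ is the graph on this free part joining distinct $x,y$ iff $s\cdot x=y$ for some $s\in S$. $\chi_B(G)$ denotes the Borel chromatic number: the least $k$ such that there is a Borel map $c$ from the vertex set to a $k$-element set with $c(x)\neq c(y)$ for adjacent $x,y$. *)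

(* Defs.v *)
From HB Require Import structures.
From mathcomp Require Import all_boot all_order all_algebra all_fingroup.
From mathcomp Require Import all_classical all_reals all_analysis.

Set Implicit Arguments.
Unset Strict Implicit.
Unset Printing Implicit Defensive.

Import GRing.Theory.
Local Open Scope classical_set_scope.

Definition generates (Gam : groupType) (S : set Gam) : Prop :=
  forall H : set Gam,
    H 1%g ->
    (forall g h, H g -> H h -> H (g * h)%g) ->
    (forall g, H g -> H g^-1%g) ->
    S `<=` H -> H = [set: Gam].

Definition marking (Gam : groupType) (S : set Gam) : Prop :=
  [/\ finite_set S, (forall s, S s -> S s^-1%g), ~ S 1%g & generates S].

(* 2^Gam with the product topology, each factor bool being discrete *)
Definition pow2 (Gam : groupType) : topologicalType :=
  prod_topology (fun _ : Gam => bool).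

Definition shift (Gam : groupType) (g : Gam) (x : pow2 Gam) : pow2 Gam :=
  fun h => x (g^-1 * h)%g.

Definition free_part (Gam : groupType) : set (pow2 Gam) :=
  [set x | forall g : Gam, g <> 1%g -> shift g x <> x].
Arguments free_part : clear implicits.

(* The vertex space F(2^Gam): [set_type] carries the subspace topology. *)
Definition F2 (Gam : groupType) : topologicalType :=
  set_type (free_part Gam).

Definition shift_graph (Gam : groupType) (S : set Gam) (x y : F2 Gam) : Prop :=
  x <> y /\ exists2 s, S s & shift s (set_val x) = set_val y.

(* [<<s open >>] is the Borel sigma-algebra of X; 'I_n is discrete. *)
Definition borel_map (X : topologicalType) (n : nat) (c : X -> 'I_n) : Prop :=
  forall A : set 'I_n, <<s @open X >> (c @^-1` A).

Definition borel_colorable (X : topologicalType) (E : X -> X -> Prop)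
    (n : nat) : Prop :=
  exists2 c : X -> 'I_n, borel_map c & forall x y, E x y -> c x <> c y.

(* chi_B (X, E) = n *)
Definition borel_chromatic_number_eq (X : topologicalType)
    (E : X -> X -> Prop) (n : nat) : Prop :=
  borel_colorable E n /\ forall m, borel_colorable E m -> (n <= m)%N.

(* Z/k x Z written multiplicatively; 'Z_k is Z/kZ only for k > 1. *)
Definition Gamma (k : nat) : groupType :=
  Algebra.to_multiplicative ('Z_k * int)%type.

Local Open Scope ring_scope.

Definition Gamma_gens (k : nat) : set (Gamma k) :=
  [set s | [\/ exists2 i : 'Z_k, i <> 0 & s = (i, 0),
               exists2 i : 'Z_k, i <> 0 /\ i <> 1 & s = (i, 1)
             | exists2 i : 'Z_k, i <> 0 /\ i <> 1 & s = (- i, -1)]].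
Arguments Gamma_gens : clear implicits.

Lemma Gamma_gens_marking (k : nat) : (3 <= k)%N -> marking (Gamma_gens k).
Proof.
move=> k3; split.
- pose D := [set: 'Z_k] `*` ((fun n : 'I_3 => n%:Z - 1) @` [set: 'I_3]).
  apply: (@sub_finite_set _ _ D); last first.
    apply: finite_setX; first exact: finite_finset.
    by apply: finite_image; exact: finite_finset.
  move=> _ [[i _ ->]|[i _ ->]|[i _ ->]]; split=> //=.
  + by exists (inord 1); rewrite ?inordK.
  + by exists (inord 2); rewrite ?inordK.
  + by exists (inord 0); rewrite ?inordK.
- move=> _ [[i i0 ->]|[i i01 ->]|[i i01 ->]].
  + apply: Or31; exists (- i); last by congr pair; rewrite oppr0.
    by move/eqP; rewrite oppr_eq0 => /eqP.
  + by apply: Or33; exists i.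
  + by apply: Or32; exists i => //; congr pair; rewrite opprK.
- by case=> -[i i0 []] //; move=> e; case: i0.
- move=> H H1 HM HV SH; rewrite -subTset => -[a n] _.
  have HA (b : 'Z_k) : H (b, 0).
    have [->|/eqP b0] := eqVneq b 0; first exact: H1.
    by apply: SH; apply: Or31; exists b.
  have two : (2 : 'Z_k) <> 0 /\ (2 : 'Z_k) <> 1.
    have k1 : (1 < k)%N by exact: leq_trans k3.
    split=> [/(congr1 (@nat_of_ord _))|e].
      by rewrite val_Zp_nat // modn_small.
    have /eqP[] := oner_neq0 'Z_k.
    by apply: (@addrI _ 1); rewrite addr0.
  pose mk (b : 'Z_k) (m : int) : Gamma k := (b, m).
  have mkM b m c l : (mk b m * mk c l)%g = mk (b + c) (m + l) by [].
  have mkV b m : (mk b m)^-1%g = mk (- b) (- m) by [].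
  have H01 : H (mk 0 1).
    have H21 : H (mk 2 1) by apply: SH; apply: Or32; exists 2.
    by move: (HM _ _ (HA (- 2)) H21); rewrite (mkM (- 2) 0) addNr add0r.
  have HN (m : nat) : H (mk 0 m%:Z).
    elim: m => [|m IH]; first exact: H1.
    by move: (HM _ _ H01 IH); rewrite mkM addr0 -intS.
  have HZ : H (mk 0 n).
    case: n => m; first exact: HN.
    by move: (HV _ (HN m.+1)); rewrite mkV oppr0 NegzE.
  by move: (HM _ _ (HA a) HZ); rewrite (mkM a 0) addr0 add0r.
Qed.

(* Main.v *)
(** In an orbit of the free part, each coset of Z/k x {0} is a k-clique, which
    gives the lower bound.  For the upper bound, a k-colouring of an orbit
    amounts to a choice, for each level n, of a rotation t_n of Z/k with
    t_(n+1) - t_n in {0, 1}, the translate of x by (i, n) receiving the colour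
    t_n - i.  Countably many independent cylinders cover the free part, and the
    first of them that a given orbit meets selects in a Borel way a nonempty set
    of markers in that orbit, no two of them within k consecutive levels.  One
    lets t_m = p at a marker (p, m); since consecutive markers are at least k
    levels apart, t can climb from one marker to the next by steps in {0, 1},
    and it is kept constant before the first and after the last marker. *)

From mathcomp Require Import all_boot all_algebra.
From mathcomp Require Import all_classical all_analysis.
From mathcomp Require Import zify.
Require Import Defs.

Set Implicit Arguments.
Unset Strict Implicit.
Unset Printing Implicit Defensive.

Import GRing.Theory Num.Theory.
Local Open Scope classical_set_scope.

Section CountableOperations.
Context {d : measure_display} {X : measurableType d}.

Lemma bigcup_countType_measurable (I : countType) (D : set I) (F : I -> set X) :
  (forall i, D i -> measurable (F i)) -> measurable (\bigcup_(i in D) F i).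
Proof.
move=> mF; rewrite bigcup_mkcond; apply: countable_bigcupT_measurable => // i.
by case: ifPn => // /set_mem /mF.
Qed.

Lemma bigcap_countType_measurable (I : countType) (D : set I) (F : I -> set X) :
  (forall i, D i -> measurable (F i)) -> measurable (\bigcap_(i in D) F i).
Proof.
move=> mF; rewrite -[X in measurable X]setCK setC_bigcap.
by apply/measurableC/bigcup_countType_measurable => i /mF /measurableC.
Qed.

Lemma measurable_preimage_countable2 (U V : countType) (W : Type)
    (u : X -> U) (v : X -> V) (h : U -> V -> W) :
  (forall a, measurable (u @^-1` [set a])) ->
  (forall b, measurable (v @^-1` [set b])) ->
  forall A, measurable ((fun x => h (u x) (v x)) @^-1` A).
Proof.
move=> mu mv A.
have -> : (fun x => h (u x) (v x)) @^-1` A =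
    \bigcup_(ab in [set ab | A (h ab.1 ab.2)])
      (u @^-1` [set ab.1] `&` v @^-1` [set ab.2]).
  apply/seteqP; split=> [x Ax|x [[a b] /= Aab [-> ->]] //].
  by exists (u x, v x).
by apply: bigcup_countType_measurable => ab _; exact: measurableI.
Qed.

End CountableOperations.

Lemma borel_preimage (X Y : topologicalType) (f : X -> Y) :
  continuous f ->
  <<s @open Y >> `<=` [set A | <<s @open X >> (f @^-1` A)].
Proof.
move=> /continuousP cf; apply: smallest_sub.
  have := sigma_algebra_image f (smallest_sigma_algebra [set: X] (@open X)).
  by rewrite /image_set_system; under eq_set do rewrite setTI.
by move=> A /cf; exact: sub_sigma_algebra.
Qed.

Lemma continuous_prod_topology (X : topologicalType) (I : Type)
    (K : I -> topologicalType) (f : X -> prod_topology K) :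
  (forall i, continuous (fun x => f x i)) -> continuous f.
Proof.
move=> cf x; apply/cvg_sup => i; move: x.
exact: (@continuous_comp_initial _ _ _ (fun y : prod_topology K => y i)).
Qed.

Section Shift.
Variable Gam : groupType.
Implicit Types (g h : Gam) (x : pow2 Gam).

Lemma shift1 x : shift 1%g x = x.
Proof. by apply/funext => a; rewrite /shift invg1 mul1g. Qed.

Lemma shiftM g h x : shift g (shift h x) = shift (g * h)%g x.
Proof. by apply/funext => a; rewrite /shift invgM mulgA. Qed.

Lemma coordinate_continuous g : continuous (fun x : pow2 Gam => x g : bool).
Proof. exact: (@proj_continuous Gam (fun=> bool) g). Qed.

Lemma shift_continuous g : continuous (@shift Gam g).
Proof.
by apply: continuous_prod_topology => h; exact: coordinate_continuous.
Qed.

End Shift.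

Local Notation borel_set := ((@open (pow2 _)).-sigma.-measurable).

Section MarkerSets.
Variable Gam : groupType.
Hypothesis countable_Gam : countable [set: Gam].
Implicit Types (g : Gam) (x : pow2 Gam) (A : set (pow2 Gam)) (D : set Gam).
Implicit Types c : set (Gam * bool).

Lemma borel_set_shift g A : borel_set A -> borel_set (shift g @^-1` A).
Proof. exact: borel_preimage (@shift_continuous Gam g) A. Qed.

Definition saturation A : set (pow2 Gam) := \bigcup_g (shift g @^-1` A).

Lemma borel_set_saturation A : borel_set A -> borel_set (saturation A).
Proof.
move=> bA; apply: countable_bigcupT_measurable => // g.
exact: borel_set_shift.
Qed.

Lemma saturation_shift A g x : saturation A (shift g x) -> saturation A x.
Proof. by move=> [h _ Ax]; exists (h * g)%g => //=; rewrite -shiftM. Qed.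

Definition independent D A : Prop :=
  forall d x, D d -> A x -> ~ A (shift d x).

Definition cylinder c : set (pow2 Gam) :=
  [set x | forall a, c a -> x a.1 = a.2].

Lemma borel_set_cylinder c : finite_set c -> borel_set (cylinder c).
Proof.
move=> finc.
have -> : cylinder c = \bigcap_(a in c) [set x : pow2 Gam | x a.1 = a.2] by [].
apply: fin_bigcap_measurable => // a _; apply: sub_sigma_algebra.
have /continuousP/(_ [set a.2]) := coordinate_continuous (g := a.1).
by apply; exact: discrete_open.
Qed.

(* Each d in D changes some coordinate h d of x, so a point and its translate by
   d cannot both agree with x at h d and d^-1 h d. *)
Lemma free_part_independent_cylinder D x :
  finite_set D -> ~ D 1%g -> free_part Gam x ->
  exists c, [/\ finite_set c, independent D (cylinder c) & cylinder c x].
Proof.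
move=> finD D1 free_x.
have /choice[h hP] d : exists h, D d -> x (d^-1 * h)%g != x h.
  have [Dd|nDd] := pselect (D d); last by exists 1%g.
  have /existsNP[h /eqP xh] : ~ forall h, shift d x h = x h.
    by move=> /funext; apply: free_x => d1; apply: D1; rewrite -d1.
  by exists h.
pose graph : Gam -> Gam * bool := fun g => (g, x g).
exists (graph @` (h @` D `|` (fun d => d^-1 * h d)%g @` D)); split.
- by apply: finite_image; rewrite finite_setU; split; exact: finite_image.
- move=> d y Dd cy cdy; have /negP := hP d Dd; apply; apply/eqP.
  have <- : y (d^-1 * h d)%g = x (d^-1 * h d)%g.
    by apply: (cy (graph _)); exists (d^-1 * h d)%g => //; right; exists d.
  by apply: (cdy (graph _)); exists (h d) => //; left; exists d.
- by move=> _ [g _ <-].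
Qed.

Section FirstMeeting.
Variables (P : set nat) (U : nat -> set (pow2 Gam)).

Definition first_meeting : set (pow2 Gam) :=
  \bigcup_(n in P)
    (U n `\` \bigcup_(m in [set m | P m /\ (m < n)%N]) saturation (U m)).

Lemma borel_set_first_meeting :
  (forall n, P n -> borel_set (U n)) -> borel_set first_meeting.
Proof.
move=> bU; apply: bigcup_measurable => n Pn.
apply: measurableD; first exact: bU.
apply: bigcup_measurable => m [Pm _].
by apply: borel_set_saturation; exact: bU.
Qed.

Lemma independent_first_meeting D :
  (forall n, P n -> independent D (U n)) -> independent D first_meeting.
Proof.
move=> indU d x Dd [n Pn [Un notbefore_n]] [m Pm [Um notbefore_m]].
case: (ltngtP m n) => [mn|nm|mn].
- by apply: notbefore_n; exists m => //; exists d.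
- apply: notbefore_m; exists n => //; exists d^-1%g => //=.
  by rewrite shiftM mulVg shift1.
- by subst m; exact: indU Un Um.
Qed.

Lemma sub_saturation_first_meeting :
  \bigcup_(n in P) U n `<=` saturation first_meeting.
Proof.
move=> x [n Pn Un].
have met : exists n, `[< P n /\ saturation (U n) x >].
  by exists n; apply/asboolP; split=> //; exists 1%g => //=; rewrite shift1.
case: (ex_minnP met) => {n Pn Un} n /asboolP[Pn [g _ Un]] min_n.
exists g => //=; exists n => //; split=> // -[m [Pm mn] /saturation_shift Um].
have /min_n : `[< P m /\ saturation (U m) x >] by exact/asboolP.
by rewrite leqNgt mn.
Qed.

End FirstMeeting.

Theorem borel_marker_set D : finite_set D -> ~ D 1%g ->
  exists M : set (pow2 Gam),
    [/\ borel_set M, independent D M & free_part Gam `<=` saturation M].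
Proof.
move=> finD D1.
have countable_patterns : countable [set c : set (Gam * bool) | finite_set c].
  have /countable_finite_subset : countable [set: Gam * bool].
    by rewrite -setXTT; exact: countableX.
  by congr countable; apply/seteqP; split=> c //= -[].
have [c surj_c] := pcard_surjP countable_patterns.
pose P := [set n | finite_set (c n) /\ independent D (cylinder (c n))].
exists (first_meeting P (cylinder \o c)); split.
- by apply: borel_set_first_meeting => n [finc _]; exact: borel_set_cylinder.
- by apply: independent_first_meeting => n [].
- move=> x /(free_part_independent_cylinder finD D1)[e [fine inde ex]].
  apply: sub_saturation_first_meeting; have [n _ cn] := surj_c e fine.
  by exists n; rewrite /P /= cn.
Qed.

End MarkerSets.

Section FirstHit.
Variable T : choiceType.
Implicit Types (f : nat -> set T) (u : option (T * nat)).

Definition is_first_hit f u : Prop :=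
  match u with
  | Some (p, j) => f j p /\ forall l, (l < j)%N -> f l = set0
  | None => forall j, f j = set0
  end.

Definition first_hit f : option (T * nat) := xget None (is_first_hit f).

Lemma first_hitP f : is_first_hit f (first_hit f).
Proof.
apply: xgetPex.
have [met|notmet] := pselect (exists j, `[< f j !=set0 >]); last first.
  exists None => j; apply/eqP; apply: contrapT => /negP/set0P fj.
  by apply: notmet; exists j; apply/asboolP.
case: (ex_minnP met) => j /asboolP[p fjp] min_j.
exists (Some (p, j)); split=> // l lj.
apply/eqP; apply: contrapT => /negP/set0P.
by move=> /asboolP/min_j; rewrite leqNgt lj.
Qed.

Lemma first_hit_unique f u :
  (forall j, is_subset1 (f j)) -> is_first_hit f u -> first_hit f = u.
Proof.
move=> f1; have := first_hitP f.
case: (first_hit f) u => [[p j]|] [[q l]|] //=.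
- move=> [fjp min_j] [flq min_l]; case: (ltngtP j l) => jl.
  + by move: fjp; rewrite min_l.
  + by move: flq; rewrite min_j.
  + by subst l; rewrite (f1 _ _ _ fjp flq).
- by move=> [fjp _] f0; move: fjp; rewrite f0.
- by move=> f0 [flq _]; move: flq; rewrite f0.
Qed.

Lemma first_hit_at0 f p :
  (forall j, is_subset1 (f j)) -> f 0 p -> first_hit f = Some (p, 0).
Proof. by move=> f1 f0p; exact: first_hit_unique. Qed.

Definition delay_hit u : option (T * nat) := omap (fun a => (a.1, a.2.+1)) u.

Lemma first_hit_after0 f : (forall j, is_subset1 (f j)) -> f 0 = set0 ->
  first_hit f = delay_hit (first_hit (f \o succn)).
Proof.
move=> f1 f0; apply: first_hit_unique => //.
have := first_hitP (f \o succn); case: first_hit => [[p j] [fp min_j]|fS] /=.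
  by split=> // -[|l] //; exact: min_j.
by case.
Qed.

End FirstHit.

Lemma first_hit_preimage (S T : choiceType) (f : nat -> set T)
    (h : S -> T) (g : T -> S) : (forall j, is_subset1 (f j)) ->
  cancel h g -> cancel g h ->
  first_hit (fun j => h @^-1` f j) = omap (fun a => (g a.1, a.2)) (first_hit f).
Proof.
move=> f1 hK gK; apply: first_hit_unique.
  by move=> j a b fa fb; apply: (can_inj hK); exact: f1 fa fb.
have := first_hitP f; case: first_hit => [[p j] [fp min_j]|f0] /=.
  by split=> [|l /min_j ->]; [rewrite /= gK|rewrite preimage_set0].
by move=> j; rewrite f0 preimage_set0.
Qed.

Lemma first_hit_measurable d (X : measurableType d) (T : countType)
    (f : X -> nat -> set T) (u : option (T * nat)) :
  (forall x j, is_subset1 (f x j)) ->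
  (forall j p, measurable [set x | f x j p]) ->
  measurable ((fun x => first_hit (f x)) @^-1` [set u]).
Proof.
move=> f1 mf.
have mf0 j : measurable [set x | f x j = set0].
  have -> : [set x | f x j = set0] = \bigcap_(p : T) ~` [set x | f x j p].
    apply/seteqP; split=> x; first by move=> /= fxj p _ /=; rewrite fxj.
    by move=> nf; apply/seteqP; split=> p // /(nf p I).
  by apply: bigcap_countType_measurable => p _; exact: measurableC.
have -> : (fun x => first_hit (f x)) @^-1` [set u] =
    [set x | is_first_hit (f x) u].
  apply/seteqP; split=> x /=; first by move=> <-; exact: first_hitP.
  exact: first_hit_unique.
pose F0 j := [set x | f x j = set0].
case: u => [[p j]|] /=.
  apply: measurableI; first exact: mf.
  apply: (bigcap_countType_measurable (D := [set l | (l < j)%N]) (F := F0)).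
  by move=> l _; exact: mf0.
rewrite (_ : mkset _ = \bigcap_j F0 j).
  by apply: bigcap_countType_measurable => j _; exact: mf0.
by apply/seteqP; split=> x f0 j; [move=> _; exact: f0|exact: (f0 j I)].
Qed.

Section Rotation.
Variable k : nat.
Hypothesis k_gt1 : (1 < k)%N.
Local Open Scope ring_scope.
Implicit Types (p q i : 'Z_k) (m n l : int) (Q : int -> set 'Z_k).

Definition spaced Q : Prop := forall m (j : nat) p q,
  (j < k)%N -> Q m p -> Q (m + j%:Z) q -> p = q /\ j = 0%N.

Lemma spaced_subset1 Q m : spaced Q -> is_subset1 (Q m).
Proof.
move=> spQ p q Qp Qq; have [] // := spQ m 0%N p q (ltnW k_gt1) Qp.
by rewrite addr0.
Qed.

Definition gap p q : nat := (q - p)%R.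
Arguments gap : simpl never.

Lemma gap_lt p q : (gap p q < k)%N.
Proof. by rewrite -[X in (_ < X)%N](Zp_cast k_gt1) ltn_ord. Qed.

Lemma add_gap p q : p + (gap p q)%:R = q.
Proof. by rewrite natr_Zp addrC subrK. Qed.

Lemma gap_translate i p q : gap (p - i) (q - i) = gap p q.
Proof. by rewrite /gap opprB addrA subrK. Qed.

Definition interpolate (u v : option ('Z_k * nat)) : 'Z_k :=
  match u, v with
  | Some (p, j), Some (q, _) => p + (minn j (gap p q))%:R
  | Some (p, _), None => p
  | None, Some (q, _) => q
  | None, None => 0
  end.

Definition last_mark Q n : option ('Z_k * nat) :=
  first_hit (fun j => Q (n - j%:Z)).

Definition next_mark Q n : option ('Z_k * nat) :=
  first_hit (fun j => Q (n + j.+1%:Z)).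

Definition rotation Q n : 'Z_k := interpolate (last_mark Q n) (next_mark Q n).

Lemma last_markP Q n : is_first_hit (fun j => Q (n - j%:Z)) (last_mark Q n).
Proof. exact: first_hitP. Qed.

Lemma next_markP Q n : is_first_hit (fun j => Q (n + j.+1%:Z)) (next_mark Q n).
Proof. exact: first_hitP. Qed.

Lemma last_mark_delay Q n : spaced Q -> Q (n + 1) = set0 ->
  last_mark Q (n + 1) = delay_hit (last_mark Q n).
Proof.
move=> spQ Q0; rewrite {1}/last_mark first_hit_after0 ?subr0 //; last first.
  by move=> j; exact: spaced_subset1.
by congr (delay_hit (first_hit _)); apply/funext => j /=; congr Q; lia.
Qed.

Lemma next_mark_delay Q n : spaced Q -> Q (n + 1) = set0 ->
  next_mark Q n = delay_hit (next_mark Q (n + 1)).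
Proof.
move=> spQ Q0; rewrite {1}/next_mark first_hit_after0 //; last first.
  by move=> j; exact: spaced_subset1.
by congr (delay_hit (first_hit _)); apply/funext => j /=; congr Q; lia.
Qed.

Lemma rotation_mark Q n p : spaced Q -> Q n p -> rotation Q n = p.
Proof.
move=> spQ Qp; rewrite /rotation.
have -> : last_mark Q n = Some (p, 0%N).
  by apply: first_hit_at0; [move=> j; exact: spaced_subset1|rewrite subr0].
by case: (next_mark Q n) => [[q l]|] //=; rewrite min0n addr0.
Qed.

Lemma rotation_before_mark Q n q : spaced Q -> Q (n + 1) q -> rotation Q n = q.
Proof.
move=> spQ Qq; rewrite /rotation.
have -> : next_mark Q n = Some (q, 0%N).
  by apply: first_hit_at0 => // j; exact: spaced_subset1.
have := last_markP Q n; case: (last_mark Q n) => [[p j] [Qp _]|_] //=.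
have kj : (k <= j.+1)%N.
  rewrite leqNgt; apply/negP => jk.
  have [|_ //] := spQ _ j.+1 p q jk Qp.
  by rewrite (_ : _ + _ = n + 1) //; lia.
by rewrite (minn_idPr _) ?add_gap // -ltnS (leq_trans (gap_lt p q)).
Qed.

Lemma rotation_markless Q n : spaced Q -> Q (n + 1) = set0 ->
  exists b : bool, rotation Q (n + 1) = rotation Q n + b%:R.
Proof.
move=> spQ Q0; rewrite /rotation last_mark_delay // (next_mark_delay spQ Q0).
case: (last_mark Q n) (next_mark Q (n + 1)) => [[p j]|] [[q l]|] /=;
  try by exists false; rewrite addr0.
exists (j < gap p q)%N. rewrite -addrA -natrD; congr (_ + _%:R).
by case: (ltnP j (gap p q)); lia.
Qed.

Lemma rotation_step Q n : spaced Q ->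
  exists b : bool, rotation Q (n + 1) = rotation Q n + b%:R.
Proof.
move=> spQ; have [|/set0P[q Qq]] := eqVneq (Q (n + 1)) set0.
  exact: rotation_markless.
exists false.
by rewrite (rotation_mark spQ Qq) (rotation_before_mark spQ Qq) addr0.
Qed.

Lemma last_or_next_mark Q n m : Q m !=set0 ->
  last_mark Q n <> None \/ next_mark Q n <> None.
Proof.
move=> [p Qmp]; have [le_mn|lt_nm] := lerP m n; [left|right] => no_mark.
- have := last_markP Q n; rewrite no_mark => /(_ `|n - m|%N).
  by rewrite (_ : n - _ = m); [move=> Q0; move: Qmp; rewrite Q0|lia].
- have := next_markP Q n; rewrite no_mark => /(_ `|m - n|.-1%N).
  by rewrite (_ : n + _ = m); [move=> Q0; move: Qmp; rewrite Q0|lia].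
Qed.

Definition rotate_mark i : option ('Z_k * nat) -> option ('Z_k * nat) :=
  omap (fun a => (a.1 - i, a.2)).

Lemma interpolate_rotate_mark i u v : u <> None \/ v <> None ->
  interpolate (rotate_mark i u) (rotate_mark i v) = interpolate u v - i.
Proof.
case: u => [[p j]|]; case: v => [[q l]|] //=; last by case.
by rewrite gap_translate addrAC.
Qed.

Lemma rotation_translate Q i l n m : spaced Q -> Q m !=set0 ->
  rotation (fun m => +%R^~ i @^-1` Q (m + l)) n = rotation Q (n + l) - i.
Proof.
move=> spQ Qm.
rewrite -(interpolate_rotate_mark _ (last_or_next_mark (n + l) Qm)).
have rotate_hit (f : nat -> int) :
    first_hit (fun j => +%R^~ i @^-1` Q (f j)) =
    rotate_mark i (first_hit (fun j => Q (f j))).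
  apply: (first_hit_preimage (g := +%R^~ (- i)) _ (addrK i) (subrK i)) => j.
  exact: spaced_subset1.
congr interpolate; rewrite -rotate_hit; congr first_hit;
  by apply/funext => j; congr (_ @^-1` Q _); lia.
Qed.

End Rotation.

Section Coloring.
Variable k : nat.
Hypothesis k_gt1 : (1 < k)%N.
Local Open Scope ring_scope.

Lemma shift_pair (p q : 'Z_k) (m n : int) (x : pow2 (Gamma k)) :
  shift ((p, m) : Gamma k) (shift ((q, n) : Gamma k) x) =
  shift ((p + q, m + n) : Gamma k) x.
Proof. exact: shiftM. Qed.

Definition window : set ('Z_k * int) := [set: 'Z_k] `*` (Posz @` `I_k) `\ 0.

Lemma finite_window : finite_set window.
Proof.
apply: finite_setD; apply: finite_setX; first exact: finite_finset.
by apply: finite_image; exact: finite_II.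
Qed.

Variable M : set (pow2 (Gamma k)).
Hypothesis borelM : borel_set M.
Hypothesis independentM : independent (window : set (Gamma k)) M.

Definition marks (x : pow2 (Gamma k)) (m : int) : set 'Z_k :=
  [set p | M (shift ((p, m) : Gamma k) x)].

Lemma marks_spaced x : spaced (marks x).
Proof.
move=> m j p q jk Mp Mq; apply: contrapT => neq.
apply: (independentM (d := (q - p, j%:Z)) _ Mp).
  split; first by split=> //; exists j.
  move=> /pair_equal_spec[/subr0_eq qp [j0]]; exact: neq.
by rewrite shift_pair subrK addrC.
Qed.

Definition rotation_color (x : pow2 (Gamma k)) : 'Z_k := rotation (marks x) 0.

Lemma rotation_color_shift x i l : saturation M x ->
  rotation_color (shift ((i, l) : Gamma k) x) = rotation (marks x) l - i.
Proof.
move=> [[p m] _ Mp].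
rewrite -[l in RHS]add0r -(@rotation_translate _ k_gt1 _ _ _ _ m).
- congr rotation; apply/funext => n; apply/funext => q.
  by rewrite /marks /= shift_pair.
- exact: marks_spaced.
- by exists p.
Qed.

Lemma borel_rotation_color A : borel_set (rotation_color @^-1` A).
Proof.
have bmarks m p : borel_set [set x | marks x m p] by exact: borel_set_shift.
apply: measurable_preimage_countable2 => u; apply: first_hit_measurable => //.
- by move=> x j; apply: (spaced_subset1 k_gt1); exact: marks_spaced.
- by move=> x j; apply: (spaced_subset1 k_gt1); exact: marks_spaced.
Qed.

Lemma rotation_color_proper x s : saturation M x -> Gamma_gens k s ->
  rotation_color (shift s x) <> rotation_color x.
Proof.
move=> satx Ss; have spx : spaced (marks x) by exact: marks_spaced.
have bool_neq (b : bool) i : i <> 0 -> i <> 1 -> b%:R <> i :> 'Z_k.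
  by case: b => i0 i1 e; [apply: i1|apply: i0].
case: Ss => [[i i0 ->]|[i [i0 i1] ->]|[i [i0 i1] ->]];
  rewrite rotation_color_shift //.
- by move=> /eqP; rewrite -subr_eq0 addrAC subrr add0r oppr_eq0 => /eqP.
- have [b] := rotation_step k_gt1 0 spx; rewrite add0r => ->.
  by move=> /(canRL (subrK i))/addrI; exact: bool_neq.
- have [b] := rotation_step k_gt1 (-1) spx; rewrite addNr opprK.
  by rewrite /rotation_color => -> /addrI/esym; exact: bool_neq.
Qed.

End Coloring.

Lemma shift_graph_colorable (k : nat) : (1 < k)%N ->
  borel_colorable (shift_graph (Gamma_gens k)) k.
Proof.
case: k => [|[|n]] // k_gt1.
have countable_Gamma : countable [set: Gamma n.+2].
  exact: (@countableP ('Z_n.+2 * int)%type).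
have not_window1 : ~ @window n.+2 (1%g : Gamma n.+2) by case=> _; exact.
have [M [bM indM coverM]] :=
  borel_marker_set countable_Gamma (@finite_window n.+2) not_window1.
exists (fun x : F2 (Gamma n.+2) => rotation_color M (set_val x)) => [A|x y].
  have cval : continuous (set_val : F2 (Gamma n.+2) -> pow2 (Gamma n.+2)).
    exact: initial_continuous.
  exact: borel_preimage cval _ (borel_rotation_color k_gt1 bM indM A).
move=> [_ [s Ss xy]] /=; rewrite -xy; apply: nesym.
apply: (rotation_color_proper k_gt1 indM _ Ss).
by apply: coverM; exact: set_valP.
Qed.

Lemma clique_leq_colors (X : topologicalType) (E : X -> X -> Prop)
    (T : finType) (f : T -> X) (m : nat) :
  (forall a b, a != b -> E (f a) (f b)) -> borel_colorable E m -> (#|T| <= m)%N.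
Proof.
move=> cliqueE [c _ properc]; rewrite -[m]card_ord.
apply: (@leq_card _ _ (c \o f)) => a b cab.
by apply/eqP; apply: contraPT cab => /cliqueE/properc.
Qed.

Section PointMass.
Variable Gam : groupType.
Implicit Types (a g : Gam).

Definition point_mass a : pow2 Gam := fun h => h == a.

Lemma point_mass_inj : injective point_mass.
Proof.
by move=> a b /(congr1 (@^~ a)); rewrite /point_mass eqxx => /esym/eqP.
Qed.

Lemma shift_point_mass g a : shift g (point_mass a) = point_mass (g * a)%g.
Proof.
by apply/funext => h; rewrite /shift /point_mass (can2_eq (mulVKg g) (mulKg g)).
Qed.

Lemma point_mass_free a : free_part Gam (point_mass a).
Proof.
move=> g g1; rewrite shift_point_mass => /point_mass_inj ga.
by apply: g1; apply: (mulIg a); rewrite mul1g.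
Qed.

Definition free_point_mass a : F2 Gam :=
  exist _ (point_mass a) (mem_set (@point_mass_free a)).

Lemma shift_graph_point_mass (S : set Gam) a b : a != b -> S (b * a^-1)%g ->
  shift_graph S (free_point_mass a) (free_point_mass b).
Proof.
move=> ab Sba; split.
  by move=> /(congr1 set_val)/point_mass_inj/eqP; apply/negP.
by exists (b * a^-1)%g => //; rewrite shift_point_mass mulgVK.
Qed.

End PointMass.

Lemma leq_shift_graph_colors (k m : nat) : (1 < k)%N ->
  borel_colorable (shift_graph (Gamma_gens k)) m -> (k <= m)%N.
Proof.
move=> k_gt1 colorable_m; have <- : #|'Z_k| = k by rewrite card_ord Zp_cast.
apply: (clique_leq_colors
  (f := fun i : 'Z_k => free_point_mass ((i, 0%R) : Gamma k)) _ colorable_m).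
move=> i j ij; apply: shift_graph_point_mass.
  by apply: contra_neq ij => -[].
apply: Or31; exists (j - i)%R => //.
by move=> /subr0_eq ji; move: ij; rewrite ji eqxx.
Qed.

Theorem theorem4 (k : nat) (hk : (3 <= k)%N) :
  borel_chromatic_number_eq (shift_graph (Gamma_gens k)) k.
Proof.
have k_gt1 : (1 < k)%N by exact: leq_trans hk.
by split=> [|m]; [exact: shift_graph_colorable|exact: leq_shift_graph_colors].
Qed.
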